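(* Let $B$ be a standard one-dimensional Brownian motion. For any continuous function $f\colon\mathbb{R}^+\to\mathbb{R}$ there exists a (deterministic) set $A_f\subset\mathbb{R}^+$ with Hausdorff dimension $\dim(A_f)\le 1/2$ such that, almost surely, all isolated points of $\mathcal{Z}(B-f)=\{t>0: B(t)=f(t)\}$ are contained in $A_f$.
   Context: $\mathbb{R}^+=[0,\infty)$; $B=(B(t))_{t\ge 0}$ starts at $0$. For a real function $g$ on $\mathbb{R}^+$, $\mathcal{Z}(g)$ denotes the set of zeros of $g$ in $(0,\infty)$. $\dim$ denotes Hausdorff dimension. *)

(* Defs.v *)
From HB Require Import structures.
From mathcomp Require Import all_boot all_order all_algebra.
From mathcomp Require Import all_classical all_reals all_analysis.

Set Implicit Arguments.
Unset Strict Implicit.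
Unset Printing Implicit Defensive.

Import Order.TTheory GRing.Theory Num.Theory.
Import numFieldNormedType.Exports.

Local Open Scope classical_set_scope.
Local Open Scope ring_scope.

Section hausdorff_dimension.
Context {R : realType}.
Local Open Scope ereal_scope.

(* For the empty set this is the supremum of the empty set, i.e. -oo. *)
Definition diam (U : set R) : \bar R :=
  ereal_sup [set `|x - y|%:E | x in U & y in U].

(* The empty set contributes 0 for every s, also for s = 0, while a singleton
   contributes 0 `^ 0 = 1 for s = 0; so the 0-dimensional Hausdorff measure is
   the counting measure. *)
Definition diam_pow (s : R) (U : set R) : \bar R :=
  if U == set0 then 0 else diam U `^ s.

Definition hausdorff_premeasure (s delta : R) (A : set R) : \bar R :=
  ereal_inf [set \sum_(0 <= i <oo) diam_pow s (U i) | U in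
    [set U : (set R)^nat | (forall i, diam (U i) <= delta%:E) /\
                           A `<=` \bigcup_i U i]].

Definition hausdorff_measure (s : R) (A : set R) : \bar R :=
  ereal_sup [set hausdorff_premeasure s delta A |
    delta in [set x : R | (0 < x)%R]].

Definition hausdorff_dim (A : set R) : \bar R :=
  ereal_inf [set s%:E | s in [set s : R | (0 <= s)%R /\
                                          hausdorff_measure s A = 0]].

End hausdorff_dimension.

Section brownian_motion.
Context {d : measure_display} {T : measurableType d} {R : realType}.
Variable P : probability T R.

(* Taking some of the sets equal to setT gives the product rule for every
   subfamily. *)
Definition independent_RVs (n : nat) (X : 'I_n -> T -> R) : Prop :=
  forall A : 'I_n -> set R, (forall i, measurable (A i)) ->
    P (\bigcap_(i in [set: 'I_n]) (X i @^-1` A i)) =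
    (\prod_(i < n) P (X i @^-1` A i))%E.

(* The time set is [0, +oo[: B t is irrelevant for t < 0.  The second parameter
   of normal_prob is the standard deviation, so the increments have variance
   t - s. *)
Record standard_brownian_motion (B : R -> {RV P >-> R}) : Prop := {
  bm_start : {ae P, forall w, B 0 w = 0} ;
  bm_independent_increments : forall (n : nat) (t : R^nat),
    0 <= t 0%N -> nondecreasing_seq t ->
    independent_RVs (fun (i : 'I_n) w => B (t i.+1) w - B (t i) w) ;
  bm_normal_increments : forall s t : R, 0 <= s -> s < t ->
    forall A : set R, measurable A ->
      P ((fun w => B t w - B s w) @^-1` A) =
      normal_prob 0 (Num.sqrt (t - s)) A ;
  bm_continuous : {ae P, forall w, {within `[0, +oo[, continuous (B ^~ w)}}
}.

End brownian_motion.

Definition zeros {R : realType} (g : R -> R) : set R :=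
  [set t | 0 < t /\ g t = 0].

(* Main.v *)
(** Let [X = B - f].  An isolated zero [t] of [X] is the first zero after some
    rational [q], and [X] keeps a constant sign on some interval [(t, t + eps)],
    say [X > 0].  If [f (t + h) - f t > - sqrt h] for arbitrarily small [h], then
    along a sparse sequence of such [h] the increments of [B] after the stopping
    time [t] are nearly independent, so almost surely one of them is below
    [- sqrt h] and [X (t + h) < 0], a contradiction.  Hence almost surely
    [f t - f (t + h) >= sqrt h] for all small [h > 0] (for the other sign,
    [f (t + h) - f t >= sqrt h]).  The set [A_f] of points with one of these two
    properties has dimension at most 1/2: it is a countable union of pieces on
    which [f] is injective with a 2-Hölder inverse.

    The strong Markov property is avoided by a discretisation: [t] is replaced by
    the first point [u] of the grid [q + k / n] at which [|X| <= 1 / m].  Events on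
    the increments after [u] are independent of the grid history, and the scales
    [h] may be chosen as a deterministic function of [u]. *)

Require Import Defs.
From HB Require Import structures.
From mathcomp Require Import all_boot all_order all_algebra.
From mathcomp Require Import all_classical all_reals all_analysis.
From mathcomp Require Import measurable_realfun ring lra.

Import Order.TTheory GRing.Theory Num.Theory.
Import numFieldNormedType.Exports.

Local Open Scope classical_set_scope.
Local Open Scope ring_scope.

Set Implicit Arguments.
Unset Strict Implicit.
Unset Printing Implicit Defensive.

(** * Null sets of Hausdorff measures and upper bounds on dimension *)

Section hausdorff.
Context {R : realType}.
Implicit Types (s : R) (A : set R) (U : (set R)^nat).

Lemma diam_pow_ge0 s (A : set R) : (0 <= diam_pow s A)%E.
Proof. by rewrite /diam_pow; case: ifP => // _; exact: poweR_ge0. Qed.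

Lemma hausdorff_premeasure_ge0 s delta A :
  (0 <= hausdorff_premeasure s delta A)%E.
Proof.
apply: le_ereal_inf_tmp => _ [U _ <-].
by apply: nneseries_ge0 => n _ _; exact: diam_pow_ge0.
Qed.

Lemma hausdorff_premeasure_eq0P s delta A :
  hausdorff_premeasure s delta A = 0%E <->
  forall e : R, 0 < e -> exists U,
    [/\ forall i, (diam (U i) <= delta%:E)%E, A `<=` \bigcup_i U i &
        (\sum_(0 <= i <oo) diam_pow s (U i) <= e%:E)%E].
Proof.
split=> [H e e0|H].
  have fn : hausdorff_premeasure s delta A \is a fin_num by rewrite H.
  have [_ [U [dU AU] <-]] := lb_ereal_inf_adherent e0 fn.
  rewrite -/(hausdorff_premeasure s delta A) H add0e => lt.
  by exists U; split => //; exact: ltW.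
apply/eqP; rewrite eq_le hausdorff_premeasure_ge0 andbT.
apply/lee_addgt0Pr => e e0; rewrite add0e.
have [U [dU AU Ue]] := H e e0.
by apply: le_trans Ue; apply: ereal_inf_lbound; exists U.
Qed.

(** A cover of [E n] of cost at most [e / 2 ^ n.+1] is taken for each [n], and the double sequence
    of covering sets is listed through a bijection of [nat] with [nat * nat]. *)
Lemma hausdorff_premeasure_bigcup_null s delta (E : (set R)^nat) :
  (forall i, hausdorff_premeasure s delta (E i) = 0%E) ->
  hausdorff_premeasure s delta (\bigcup_i E i) = 0%E.
Proof.
move=> E0; apply/hausdorff_premeasure_eq0P => e e0.
have /choice[G PG] n : exists U,
    [/\ forall i, (diam (U i) <= delta%:E)%E, E n `<=` \bigcup_i U i &
        (\sum_(0 <= i <oo) diam_pow s (U i) <= (e / (2 ^ n.+1)%:R)%:E)%E].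
  have /hausdorff_premeasure_eq0P := E0 n; apply.
  by rewrite divr_gt0// ltr0n expn_gt0.
have /card_esym/ppcard_eqP[f] := card_nat2.
exists (fun i => uncurry G (f i)); split.
- by move=> i; case: (f i) => a b; have [+ _ _] := PG a; exact.
- move=> x [i _ Eix]; have [_ /(_ _ Eix)[j _ Gx] _] := PG i.
  by exists (f^-1%FUN (i, j)) => //=; rewrite invK ?inE.
- rewrite nneseries_esumT; last by move=> n; exact: diam_pow_ge0.
  rewrite -(@reindex_esum _ _ _ setT setT f (fun p => diam_pow s (uncurry G p)));
    last exact: bij.
  rewrite (_ : [set: nat * nat] = setT `*`` (fun=> setT)); last first.
    by apply/seteqP; split => // -[].
  rewrite (_ : (fun p => _) = (fun k => diam_pow s (G k.1 k.2)));
    last by apply/funext => -[].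
  rewrite -(@esum_esum _ _ _ setT (fun=> setT) (fun i j => diam_pow s (G i j)));
    last by move=> *; exact: diam_pow_ge0.
  rewrite -nneseries_esumT; last first.
    by move=> n; apply: esum_ge0 => *; exact: diam_pow_ge0.
  apply: le_trans (epsilon_trick0 xpredT (ltW e0)).
  apply: lee_nneseries => [n _ _|n _].
    by apply: esum_ge0 => *; exact: diam_pow_ge0.
  rewrite -nneseries_esumT; last by move=> k; exact: diam_pow_ge0.
  by have [_ _] := PG n.
Qed.

Lemma hausdorff_measure_null s A :
  (forall delta, 0 < delta -> hausdorff_premeasure s delta A = 0%E) ->
  hausdorff_measure s A = 0%E.
Proof.
move=> A0; rewrite /hausdorff_measure.
have -> : [set hausdorff_premeasure s delta A | delta in [set x | 0 < x]] =
    [set 0%E].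
  apply/seteqP; split=> [_ [d /= d0 <-]|_ ->]; first exact: A0.
  by exists 1 => //=; rewrite A0.
by rewrite ereal_sup1.
Qed.

Lemma hausdorff_dim_le r A : 0 <= r ->
  (forall s, r < s -> hausdorff_measure s A = 0%E) ->
  (hausdorff_dim A <= r%:E)%E.
Proof.
move=> r0 A0; apply/lee_addgt0Pr => e e0; rewrite -EFinD.
apply: ereal_inf_lbound; exists (r + e) => //; split.
  by rewrite addr_ge0// ltW.
by apply: A0; rewrite ltrDl.
Qed.
End hausdorff.

(** * Dimension of the points of square-root growth *)

Section square_root_growth.
Context {R : realType}.
Implicit Types (f : R -> R) (s l : R).

(** On [E], a rise of [f] by at most [x] takes time at most [x ^+ 2]. Cutting the range [[l, l + 1)]
    into [n] intervals of length [x = 1 / n] thus covers [E] by [n] sets of diameter at most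
    [x ^+ 2]. Their total cost is at most [x] to the power [2 * s - 1], which is small with [x]
    because [s > 1/2]. *)
Lemma hausdorff_premeasure_sqrt_growth_null f s (delta : R) l (E : set R) :
  2^-1 < s -> 0 < delta ->
  (forall t u, E t -> E u -> t < u -> Num.sqrt (u - t) <= f u - f t) ->
  (forall t, E t -> l <= f t < l + 1) ->
  hausdorff_premeasure s delta E = 0%E.
Proof.
move=> s12 d0 fE fl; apply/hausdorff_premeasure_eq0P => e e0.
have p0 : 0 < 2 * s - 1 by lra.
(* The bounds by [delta] and 1 give [x ^+ 2 <= delta]; the third one makes [x] to the power
   [2 * s - 1] at most [e]. *)
pose c := Num.min (Num.min delta 1) (e `^ (2 * s - 1)^-1).
have c0 : 0 < c by rewrite !lt_min d0 ltr01 powR_gt0.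
pose n := (Num.trunc c^-1).+1; pose x : R := n%:R^-1.
have n0 : (0 < n%:R :> R) by rewrite ltr0n.
have x0 : 0 < x by rewrite invr_gt0.
have xc : x <= c.
  by rewrite invf_ple ?posrE//; apply/ltW; rewrite truncnS_gt.
have [xd x1 xe] : [/\ x <= delta, x <= 1 & x <= e `^ (2 * s - 1)^-1].
  by move: xc; rewrite !le_min => /andP[/andP[-> ->] ->].
pose U i : set R := if (i < n)%N then
  E `&` [set t | l + i%:R * x <= f t < l + i.+1%:R * x] else set0.
have dU i : (diam (U i) <= (x ^+ 2)%:E)%E.
  apply: ge_ereal_sup => _ [t Ut [u Uu <-]]; rewrite lee_fin.
  move: Ut Uu; rewrite /U; case: ifP => // _ [Et /= /andP[ft1 ft2]].
  move=> [Eu /= /andP[fu1 fu2]].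
  have key v w : E v -> E w -> v <= w -> f w - f v <= x -> w - v <= x ^+ 2.
    move=> Ev Ew; rewrite le_eqVlt => /predU1P[->|vw] fx.
      by rewrite subrr sqr_ge0.
    rewrite -[leLHS]sqr_sqrtr; last by rewrite subr_ge0 ltW.
    rewrite ler_pXn2r ?nnegrE ?sqrtr_ge0 ?(ltW x0)//.
    exact: le_trans (fE _ _ Ev Ew vw) fx.
  rewrite -natr1 mulrDl mul1r in ft2 fu2.
  case: (leP t u) => tu; [rewrite distrC ger0_norm|rewrite ger0_norm].
  - by apply: key => //; lra.
  - by rewrite subr_ge0.
  - by apply: key => //; [exact: ltW|lra].
  - by rewrite subr_ge0 ltW.
exists U; split => [i| |].
- by apply: le_trans (dU i) _; rewrite lee_fin; nra.
- move=> t Et; have /andP[f1 f2] := fl _ Et.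
  pose i := Num.trunc ((f t - l) / x).
  have q0 : 0 <= (f t - l) / x by rewrite divr_ge0 ?subr_ge0// ltW.
  have /andP[i1 i2] := truncn_itv q0; rewrite -/i in i1 i2.
  move: i1 i2; rewrite ler_pdivlMr// ltr_pdivrMr// => i1 i2.
  have lin : (i < n)%N.
    rewrite -(ltr_nat R) -(ltr_pM2r x0); apply: le_lt_trans i1 _.
    by rewrite mulfV ?gt_eqF//; lra.
  by exists i => //; rewrite /U lin; split => //=; apply/andP; split; lra.
- have Ue i : (diam_pow s (U i) <= (x * e)%:E)%E.
    rewrite /diam_pow; case: ifPn => [_|/set0P[t Ut]].
      by rewrite lee_fin mulr_ge0// ltW.
    (* Nonemptiness matters here: the diameter of the empty set is -oo. *)
    have d1 : (0 <= diam (U i))%E.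
      apply: ereal_sup_ubound; exists t => //; exists t => //.
      by rewrite subrr normr0.
    apply: (@le_trans _ _ ((x ^+ 2)%:E `^ s)%E).
      apply: gt0_ler_poweR => //; first lra.
        by rewrite in_itv/= d1 leey.
      by rewrite in_itv/= leey lee_fin sqr_ge0.
    rewrite poweR_EFin lee_fin -powR_mulrn ?(ltW x0)// -powRrM.
    rewrite (_ : 2%:R * s = 1 + (2 * s - 1)); last by ring.
    rewrite powRD; last by rewrite (gt_eqF x0) implybT.
    rewrite powRr1 ?(ltW x0)// ler_pM2l//.
    apply: (@le_trans _ _ ((e `^ (2 * s - 1)^-1) `^ (2 * s - 1))).
      by rewrite ge0_ler_powR// ?nnegrE ?powR_ge0 ?(ltW x0) ?(ltW p0).
    by rewrite -powRrM mulVf ?gt_eqF// powRr1// ltW.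
  apply: lime_le; first by apply: is_cvg_nneseries => *; exact: diam_pow_ge0.
  near=> m.
  rewrite (@big_cat_nat _ _ _ n)//=; last by near: m; exact: nbhs_infty_ge.
  rewrite [X in (_ + X)%E]big_nat_cond [X in (_ + X)%E]big1 ?adde0;
    last first.
    by move=> i /andP[/andP[ni _] _]; rewrite /U ltnNge ni /diam_pow eqxx.
  apply: le_trans (lee_sum _ (fun i _ => Ue i)) _.
  rewrite sumEFin lee_fin sumr_const_nat subn0 -mulr_natl mulrA.
  by rewrite divff ?mul1r// gt_eqF.
Unshelve. all: by end_near. Qed.

Definition sqrt_growth_points f : set R :=
  [set t | 0 <= t /\ exists2 d, 0 < d &
    forall h, 0 < h -> h < d -> Num.sqrt h <= f (t + h) - f t].

(** Null sets for a fixed [s > 1/2] add up countably, so it is enough to split both sets into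
    countably many pieces with a uniform threshold and function values in a unit interval. *)
Lemma hausdorff_dim_sqrt_growth_points f g :
  (hausdorff_dim (sqrt_growth_points f `|` sqrt_growth_points g) <=
   (2^-1)%:E)%E.
Proof.
apply: hausdorff_dim_le => // s s12.
apply: hausdorff_measure_null => delta d0.
(* The index [(j, k, l)] fixes a time window of length [1 / (j + 1)], on which the growth bound has
   that same range and so applies to any two points of the piece, and a unit window [[l, l + 1)] for
   the values. *)
pose piece (h : R -> R) (p : nat * nat * int) : set R :=
  [set t | [/\ p.1.2%:R / p.1.1.+1%:R <= t < p.1.2.+1%:R / p.1.1.+1%:R,
     forall y, 0 < y -> y < p.1.1.+1%:R^-1 -> Num.sqrt y <= h (t + y) - h t &
     p.2%:~R <= h t < p.2%:~R + 1]].
have piece0 h p : hausdorff_premeasure s delta (piece h p) = 0%E.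
  case: p => [[j k] l].
  apply: (@hausdorff_premeasure_sqrt_growth_null h _ _ l%:~R) => //.
    move=> t u [/= /andP[t1 t2] th _] [/= /andP[u1 u2] _ _] tu.
    have := th (u - t); rewrite [t + _]addrC subrK; apply.
      by rewrite subr_gt0.
    move: t1 u2; rewrite -[k.+1%:R]natr1 mulrDl mul1r.
    set b := _^-1; set a := _ * b => ? ?; lra.
  by move=> t [].
have cover h : sqrt_growth_points h `<=` \bigcup_p piece h p.
  move=> t [t0 [d dd hd]].
  pose j := Num.trunc d^-1.
  exists (j, Num.trunc (t * j.+1%:R), Num.floor (h t)) => //; split => /=.
  - rewrite ler_pdivrMr// ltr_pdivlMr//; apply: truncn_itv.
    by rewrite mulr_ge0.
  - move=> y y0 yj; apply: hd => //; apply: lt_trans yj _.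
    by rewrite invf_plt ?posrE// truncnS_gt.
  - by have := floor_itv (h t); rewrite intrD.
have [code [decode codeK]] : exists (code : bool * (nat * nat * int) -> nat)
    (decode : nat -> option (bool * (nat * nat * int))), pcancel code decode.
  by exists pickle, unpickle; exact: pickleK.
pose E n : set R := if decode n is Some p then
  piece (if p.1 then f else g) p.2 else set0.
apply/eqP; rewrite eq_le hausdorff_premeasure_ge0 andbT.
have <- : hausdorff_premeasure s delta (\bigcup_n E n) = 0%E.
  apply: hausdorff_premeasure_bigcup_null => n; rewrite /E.
  case: (decode n) => [p|]; first exact: piece0.
  apply/hausdorff_premeasure_eq0P => e e0.
  exists (fun=> set0); split => //.
    by move=> i; rewrite /diam image2E setX0 image_set0 ereal_sup0 leNye.
  by rewrite eseries0 ?lee_fin ?ltW// => *; rewrite /diam_pow eqxx.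
apply: ereal_inf_le_tmp => _ [U [dU EU] <-]; exists U => //; split => //.
apply: subset_trans EU => t [] /cover[p _ tp].
  by exists (code (true, p)) => //; rewrite /E codeK.
by exists (code (false, p)) => //; rewrite /E codeK.
Qed.
End square_root_growth.

(** * Tails of centred normal laws *)

Section normal_tails.
Context {R : realType}.
Notation mu := (@lebesgue_measure R).

Lemma normal_prob_itvcy_scale (s c : R) : 0 < s ->
  normal_prob 0 s `[s * c, +oo[ = normal_prob 0 1 `[c, +oo[.
Proof.
move=> s0.
have F'E : (fun x : R^o => s * x : R^o)^`()%classic = cst s.
  apply/funext => x; rewrite derive1E deriveM// derive_cst scaler0 addr0.
  by rewrite derive_id /GRing.scale /= mulr1.
have pdfE x : normal_pdf 0 s (s * x) * s = normal_pdf 0 1 x.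
  rewrite !normal_pdfE ?gt_eqF ?oner_neq0// mulrAC; congr (_ * _).
    rewrite /normal_peak expr1n mul1r -mulrnAr sqrtrM ?sqr_ge0// sqrtr_sqr.
    by rewrite gtr0_norm// invfM mulrAC mulVf ?mul1r// gt_eqF.
  rewrite /normal_fun !subr0 expr1n exprMn; congr expR.
  by field; rewrite gt_eqF.
have := @increasing_ge0_integration_by_substitutiony R
  (fun x : R^o => s * x) (normal_pdf 0 s) c.
rewrite /normal_prob => ->.
- apply: eq_integral => x _; rewrite F'E; congr EFin; exact: pdfE.
- by move=> x y _ _ xy; rewrite ltr_pM2l.
- by rewrite F'E => x _; exact: cvg_cst.
- by rewrite F'E; exact: is_cvg_cst.
- by rewrite F'E; exact: is_cvg_cst.
- split.
    by move=> x _; apply: derivableM.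
  apply: cvg_at_right_filter; apply: cvgM; [exact: cvg_cst|exact: cvg_id].
- by apply: gt0_cvgMry => //; exact: cvg_id.
- by apply: continuous_subspaceT; apply: continuous_normal_pdf; rewrite gt_eqF.
- by move=> x _; exact: normal_pdf_ge0.
Qed.

Lemma normal_prob_itvcy_lt1 (c : R) : (normal_prob 0 1 `[c, +oo[ < 1)%E.
Proof.
pose nu : probability _ R := normal_prob 0 (1 : R).
(* [J] lies to the left of [c] because [b <= c - 1], and to the left of 0 because [b <= - 1]. The
   density increases there, so its value [k] at [b] bounds the mass of [J] from below. *)
pose b : R := Num.min (c - 1) (- 1).
have b1 : b <= c - 1 by rewrite ge_min lexx.
have b0 : b <= - 1 by rewrite ge_min lexx orbT.
pose k : R := normal_pdf 0 1 b.
have k0 : 0 < k.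
  rewrite /k normal_pdfE ?oner_neq0// mulr_gt0 ?expR_gt0//.
  by rewrite normal_peak_gt0 ?oner_neq0.
pose J : set R := `[b, b + 1[%classic.
have mJ : measurable J by exact: measurable_itv.
have kle : (k%:E <= nu J)%E.
  rewrite /nu/= /normal_prob.
  apply: (@le_trans _ _ (\int[mu]_(x in J) (cst k%:E) x)%E).
    rewrite integral_cst//= /J.
    rewrite lebesgue_measure_itv/= lte_fin ltrDl ltr01.
    by rewrite -EFinD addrAC subrr add0r mule1.
  apply: ge0_le_integral => //=.
  - by move=> x _; rewrite lee_fin ltW.
  - apply/measurable_EFinP; apply: measurable_funTS.
    exact: measurable_normal_pdf.
  - move=> x; rewrite /J/= in_itv/= => /andP[bx xb]; rewrite lee_fin /k.
    rewrite !normal_pdfE ?oner_neq0// ler_pM2l ?normal_peak_gt0 ?oner_neq0//.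
    rewrite /normal_fun ler_expR !subr0 expr1n ler_pM2r ?invr_gt0// lerN2.
    nra.
have : (nu `[c, +oo[%classic <= 1 - nu J)%E.
  rewrite -probability_setC//; apply: le_measure; rewrite ?inE//.
    exact: measurableC.
  move=> x; rewrite /= in_itv/= andbT => cx; rewrite /J/= in_itv/= => /andP[bx xb].
  by lra.
rewrite -/(nu _) => /le_lt_trans; apply.
apply: (@le_lt_trans _ _ (1 - k%:E)%E); first by rewrite leeB.
by rewrite -EFinB lte_fin ltrBlDr ltrDl.
Qed.

(** Continuity from above along half-lines that decrease to the empty set. *)
Lemma normal_prob_itvcy_small (e : R) : 0 < e ->
  exists2 c, 0 < c & (normal_prob 0 1 `[c, +oo[ <= e%:E)%E.
Proof.
move=> e0; pose nu : probability _ R := normal_prob 0 (1 : R).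
pose F n : set R := `[n.+1%:R, +oo[%classic.
have F0 : \bigcap_n F n = set0.
  apply/seteqP; split => // x /(_ (Num.trunc x) I); rewrite /F/= in_itv/= andbT.
  by rewrite leNgt truncnS_gt.
have : nu (F n) @[n --> \oo] --> nu (\bigcap_n F n).
  apply: nonincreasing_cvg_mu.
  - apply: (le_lt_trans (probability_le1 nu _)); first exact: measurable_itv.
    exact: ltry.
  - by move=> n; rewrite /F.
  - by rewrite F0.
  - move=> m n mn; apply/subsetPset => x; rewrite /F/= !in_itv/= !andbT.
    by apply: le_trans; rewrite ler_nat ltnS.
rewrite F0 measure0 => /fine_cvgP[fin /cvgrPdist_lt/(_ _ e0)] He.
near \oo => n.
exists n.+1%:R; first by rewrite ltr0n.
have fn : nu (F n) \is a fin_num by apply: fin_num_measure; exact: measurable_itv.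
rewrite -/(nu _) -[X in (X <= _)%E](fineK fn) lee_fin ltW//.
rewrite -[ltLHS]ger0_norm ?fine_ge0//.
have : `|0 - fine (nu (F n))| < e by near: n.
by rewrite sub0r normrN.
Unshelve. all: by end_near. Qed.

End normal_tails.

(** * Gaussian increments, and independence of past and future *)

Section gaussian_increments.
Context {d : measure_display} {T : measurableType d} {R : realType}.
Variable P : probability T R.

(* Holds for both B and -B, which reduces the two possible signs of B - f to the
   right of an isolated zero to one. *)
Record gaussian_increments (X : R -> T -> R) : Prop := {
  gi_measurable : forall t, measurable_fun setT (X t) ;
  gi_independent : forall n (t : R^nat), 0 <= t 0%N -> nondecreasing_seq t ->
    independent_RVs P (fun (i : 'I_n) w => X (t i.+1) w - X (t i) w) ;
  gi_tail : forall s t c, 0 <= s -> s < t ->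
    P [set w | Num.sqrt (t - s) * c <= X t w - X s w] =
    normal_prob 0 1 `[c, +oo[ }.

Lemma brownian_gaussian_increments (B : R -> {RV P >-> R}) :
  standard_brownian_motion B -> gaussian_increments (fun t w => B t w).
Proof.
move=> [_ Bi Bn _]; split => //.
move=> s t c s0 st; rewrite -(@normal_prob_itvcy_scale _ (Num.sqrt (t - s)));
  last by rewrite sqrtr_gt0 subr_gt0.
rewrite -Bn//; congr (P _); apply/funext => w /=.
by rewrite in_itv/= andbT.
Qed.

Lemma normal_prob_itvNyc (s c : R) : s != 0 ->
  normal_prob 0 s `]-oo, - c] = normal_prob 0 s `[c, +oo[.
Proof.
move=> s0; rewrite /normal_prob ge0_integration_by_substitutionNy.
- apply: eq_integral => x _ /=; congr EFin.
  by rewrite !normal_pdfE// /normal_fun !subr0 sqrrN.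
- by apply: continuous_subspaceT; exact: continuous_normal_pdf.
- by move=> x _; exact: normal_pdf_ge0.
Qed.

Lemma brownianN_gaussian_increments (B : R -> {RV P >-> R}) :
  standard_brownian_motion B -> gaussian_increments (fun t w => - B t w).
Proof.
move=> [_ Bi Bn _]; split.
- by move=> t; exact: measurableT_comp.
- move=> n t t0 tnd A mA.
  have := Bi n t t0 tnd (fun i => -%R @^-1` A i).
  have E (i : 'I_n) : (fun w => - B (t i.+1) w - - B (t i) w) @^-1` A i =
     (fun w => B (t i.+1) w - B (t i) w) @^-1` (-%R @^-1` A i).
    by apply/funext => w /=; rewrite opprB opprK addrC.
  rewrite (eq_bigcapr (fun i _ => E i)).
  rewrite (eq_bigr _ (fun i _ => congr1 P (E i))); apply.
  by move=> i; rewrite -[X in measurable X]setTI; exact: oppr_measurable.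
- move=> s t c s0 st.
  have st0 : 0 < Num.sqrt (t - s) by rewrite sqrtr_gt0 subr_gt0.
  rewrite -(@normal_prob_itvcy_scale _ (Num.sqrt (t - s)))// -normal_prob_itvNyc ?gt_eqF//.
  rewrite -Bn//; congr (P _); apply/funext => w /=.
  by rewrite in_itv/= [in RHS]lerNr opprB opprK [- _ + _]addrC.
Qed.

Variable X : R -> T -> R.
Hypothesis hX : gaussian_increments X.

Definition increment_in (s t : R) (A : set R) : set T :=
  [set w | A (X t w - X s w)].

Definition box (t : R^nat) (A : (set R)^nat) (m n : nat) : set T :=
  [set w | forall i, (m <= i < n)%N -> A i (X (t i.+1) w - X (t i) w)].

Lemma measurable_increment s t (A : set R) : measurable A ->
  measurable (increment_in s t A).
Proof.
move=> mA; rewrite -[X in measurable X]setTI.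
have mf : measurable_fun setT (fun w => X t w - X s w).
  by apply: measurable_funB; exact: gi_measurable hX _.
exact: mf.
Qed.

Lemma measurable_box t A m n : (forall i, measurable (A i)) ->
  measurable (box t A m n).
Proof.
move=> mA.
rewrite (_ : box t A m n = \bigcap_(i in [set i | (m <= i < n)%N])
    increment_in (t i) (t i.+1) (A i)); last first.
  by apply/seteqP; split => w H i; [move=> /= /H|move=> /(H i)].
by apply: bigcap_measurableType => i _; exact: measurable_increment.
Qed.

Lemma probability_box0 (t : R^nat) (A : (set R)^nat) n :
  0 <= t 0%N -> nondecreasing_seq t -> (forall i, measurable (A i)) ->
  P (box t A 0 n) =
  (\prod_(0 <= i < n) P (increment_in (t i) (t i.+1) (A i)))%E.
Proof.
move=> t0 tnd mA; rewrite big_mkord.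
have /(_ (fun i => A i) (fun i => mA i)) := @gi_independent _ hX n t t0 tnd.
rewrite /preimage => <-; congr (P _).
apply/seteqP; split => [w H i _ /=|w H i]; first by apply: H; rewrite ltn_ord.
by move=> /andP[_ ni]; exact: (H (Ordinal ni) I).
Qed.

Lemma probability_box (t : R^nat) (A : (set R)^nat) m n : (m <= n)%N ->
  0 <= t 0%N -> nondecreasing_seq t -> (forall i, measurable (A i)) ->
  P (box t A m n) =
  (\prod_(m <= i < n) P (increment_in (t i) (t i.+1) (A i)))%E.
Proof.
move=> mn t0 tnd mA.
pose A' i := if (i < m)%N then setT else A i.
have -> : box t A m n = box t A' 0 n.
  apply/seteqP; split => w H i.
    move=> /andP[_ ni]; rewrite /A'; case: ltnP => // mi.
    by apply: H; rewrite mi.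
  by move=> /andP[mi ni]; have := H i ni; rewrite /A' ltnNge mi.
rewrite probability_box0//; last by move=> i; rewrite /A'; case: ifP.
rewrite (big_cat_nat (leq0n m) mn)/= big_nat big1 ?mul1e;
  last first.
  by move=> i /andP[_ im]; rewrite /A' im -[RHS](@probability_setT _ _ _ P).
by apply: eq_big_nat => i /andP[mi _]; rewrite /A' ltnNge mi.
Qed.

(** The generating pi-system: boxes intersect factor by factor. The sigma-algebra [past] that they
    generate is the history of the first [K] increments along [t]. *)
Definition past_boxes (t : R^nat) (K : nat) : set (set T) :=
  [set box t A 0 K | A in [set A : (set R)^nat | forall i, measurable (A i)]].

Definition past (t : R^nat) (K : nat) : set (set T) := <<s past_boxes t K >>.

Lemma past_measurable t K : past t K `<=` measurable.
Proof.
apply: smallest_sub; first exact: sigma_algebra_measurable.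
by move=> _ [A mA <-]; exact: measurable_box.
Qed.

(** The value telescopes into increments. Viewing [past t K] as the sigma-algebra of a measurable
    type makes the measurability of sums available. *)
Lemma past_value (t : R^nat) K j (A : set R) : (j <= K)%N -> measurable A ->
  past t K [set w | A (X (t j) w - X (t 0%N) w)].
Proof.
move=> jK mA.
pose TG := g_sigma_algebraType (past_boxes t K).
suff mf : measurable_fun [set: TG] (fun w : TG => X (t j) w - X (t 0%N) w).
  by have := mf measurableT A mA; rewrite setTI.
elim: j jK => [|j IH] jK.
  rewrite (_ : (fun w : TG => _) = cst 0); first exact: measurable_cst.
  by apply/funext => w; rewrite subrr.
have -> : (fun w : TG => X (t j.+1) w - X (t 0%N) w) =
    (fun w : TG => (X (t j.+1) w - X (t j) w) + (X (t j) w - X (t 0%N) w)).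
  by apply/funext => w; rewrite addrA subrK.
apply: measurable_funD; last by apply: IH; exact: ltnW.
move=> _ C mC; rewrite setTI; apply: sub_sigma_algebra.
exists (fun i => if i == j then C else setT).
  by move=> i; case: ifP.
apply/seteqP; split => w /=.
  by move=> /(_ j jK); rewrite eqxx.
by move=> Cw i iK; case: eqP => // ->.
Qed.

(** For boxes [S] this is the product rule; the pi-system uniqueness theorem for finite measures
    extends it to all of [past t K]. *)
Lemma past_box_independent (t : R^nat) (A : (set R)^nat) K n (S : set T) :
  (K <= n)%N -> 0 <= t 0%N -> nondecreasing_seq t ->
  (forall i, measurable (A i)) -> past t K S ->
  P (S `&` box t A K n) = (P S * P (box t A K n))%E.
Proof.
move=> Kn t0 tnd mA pS.
have mb : measurable (box t A K n) by exact: measurable_box.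
have fb : P (box t A K n) \is a fin_num by exact: fin_num_measure.
have pb0 : 0 <= fine (P (box t A K n)) by exact: fine_ge0.
(* Both sides are measures in [S]: [P] restricted to the future box, and [P] scaled by the
   probability of that box. *)
suff: mrestr P mb S = mscale (NngNum pb0) P S.
  by rewrite /mrestr /mscale/= fineK// muleC.
apply: (@g_sigma_algebra_measure_unique _ _ _ (past_boxes t K) _ (fun=> setT)).
- by move=> _ [A' mA' <-]; exact: measurable_box.
- by move=> _; exists (fun=> setT) => //; apply/seteqP; split.
- by rewrite bigcup_const//; exists 0%N.
- move=> _ _ [A1 mA1 <-] [A2 mA2 <-].
  exists (fun i => A1 i `&` A2 i); first by move=> i; exact: measurableI.
  apply/seteqP; split => w.
    by move=> H; split => i /H[].
  by move=> [H1 H2] i iK; split; [exact: H1|exact: H2].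
- move=> _ [A' mA' <-].
  rewrite [LHS](_ : _ = P (box t A' 0 K `&` box t A K n))//.
  have -> : box t A' 0 K `&` box t A K n =
      box t (fun i => if (i < K)%N then A' i else A i) 0 n.
    apply/seteqP; split => w.
      move=> [H1 H2] i /andP[_ ni]; case: ltnP => iK; first exact: H1.
      by apply: H2; rewrite iK.
    move=> H; split => i.
      by move=> /andP[_ iK]; have := H i (leq_trans iK Kn); rewrite iK.
    by move=> /andP[Ki ni]; have := H i ni; rewrite ltnNge Ki.
  rewrite [RHS](_ : _ = (P (box t A' 0 K) * P (box t A K n))%E); last first.
    by rewrite /= /mscale/= fineK// muleC.
  rewrite !probability_box//; last by move=> i; case: ifP.
  rewrite (big_cat_nat (leq0n K) Kn)/=; congr (_ * _)%E.
    by apply: eq_big_nat => i /andP[_ iK]; rewrite iK.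
  by apply: eq_big_nat => i /andP[Ki _]; rewrite ltnNge Ki.
- move=> k; rewrite [ltLHS](_ : _ = P (setT `&` box t A K n))//.
  by rewrite setTI ltey_eq fb.
- exact: pS.
Qed.

(** The future may run along its own times [q], unrelated to the grid [p]; the two sequences are
    glued into one and the previous lemma applies. *)
Lemma past_future_independent (p q : R^nat) (A : (set R)^nat) K n (S : set T) :
  0 <= p 0%N -> nondecreasing_seq p -> nondecreasing_seq q -> p K <= q 0%N ->
  (forall i, measurable (A i)) -> past p K S ->
  P (S `&` box q A 0 n) =
  (P S * \prod_(0 <= i < n) P (increment_in (q i) (q i.+1) (A i)))%E.
Proof.
move=> p0 pnd qnd pq mA pS.
(* The increment of index [K] joins [p K] to [q 0] and is left unconstrained; hence the shift by
   [K.+1] and the value [setT] up to and including [K]. *)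
pose t i := if (i <= K)%N then p i else q (i - K.+1)%N.
pose A' i := if (i <= K)%N then setT else A (i - K.+1)%N.
have t0 : 0 <= t 0%N by rewrite /t leq0n.
have tnd : nondecreasing_seq t.
  apply/nondecreasing_seqP => i; rewrite /t.
  have [iK|] := ltnP i K; first by rewrite (ltnW iK); exact: pnd.
  rewrite leq_eqVlt => /predU1P[<-|Ki]; first by rewrite leqnn subnn.
  by rewrite leqNgt Ki/=; apply: qnd; rewrite leq_sub2r.
have tS i : (K < i)%N -> t i = q (i - K.+1)%N by rewrite /t ltnNge => /negbTE ->.
have tK i : t (i + K.+1)%N = q i by rewrite tS ?addnK// ltn_addl.
have A'S i : (K < i)%N -> A' i = A (i - K.+1)%N by rewrite /A' ltnNge => /negbTE ->.
have A'K i : A' (i + K.+1)%N = A i by rewrite A'S ?addnK// ltn_addl.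
have mA' i : measurable (A' i) by rewrite /A'; case: ifP.
have -> : box q A 0 n = box t A' K (n + K.+1).
  apply/seteqP; split => w H i.
    move=> /andP[]; rewrite leq_eqVlt => /predU1P[<- _|Ki iKn].
      by rewrite /A' leqnn.
    rewrite A'S// (tS i Ki) (tS i.+1 (ltnW Ki)) (subSn Ki); apply: H.
    by rewrite /= ltn_subLR// addnC.
  move=> /andP[_ ni]; have := H (i + K.+1)%N.
  rewrite A'K -addSn !tK; apply.
  by rewrite ltn_add2r ni ltnW// ltn_addl.
have pS' : past t K S.
  suff : past_boxes p K = past_boxes t K by rewrite /past => <-.
  apply: eq_imagel => C _; apply/seteqP.
  by split => w H i /andP[_ iK]; have := H i iK; rewrite /t (ltnW iK) iK.
rewrite past_box_independent// ?probability_box//; last 2 first.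
  by rewrite (leq_trans (leqnSn K))// leq_addl.
  by rewrite (leq_trans (leqnSn K))// leq_addl.
congr (_ * _)%E; rewrite big_ltn ?ltn_addl//.
rewrite [X in (X * _)%E](_ : _ = 1%E) ?mul1e; last first.
  by rewrite /A' leqnn -[RHS](@probability_setT _ _ _ P).
rewrite -{1}[K.+1]add0n big_addn addnK; apply: eq_big_nat => i _.
by rewrite A'K -addSn !tK.
Qed.

End gaussian_increments.

Lemma prode_le_expr (R : realType) (a : nat -> \bar R) (r : R) n :
  (forall i, (i < n)%N -> (0 <= a i <= r%:E)%E) ->
  (\prod_(0 <= i < n) a i <= (r ^+ n)%:E)%E.
Proof.
elim: n => [|n IH] ar; first by rewrite big_nil expr0.
rewrite big_nat_recr//= exprSr EFinM; apply: lee_pmul.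
- rewrite big_nat; apply: prode_ge0 => i /= /ltnW /ar /andP[]//.
- by have /andP[] := ar n (ltnSn n).
- by apply: IH => i /ltnW; exact: ar.
- by have /andP[] := ar n (ltnSn n).
Qed.

(** * Descents along a sparse sequence of scales *)

Section no_descent.
Context {d : measure_display} {T : measurableType d} {R : realType}.
Variables (P : probability T R) (X : R -> T -> R).
Hypothesis hX : gaussian_increments P X.

(** The factor 2 leaves room for two errors below [sqrt (h i)]: the drop of [f], and the value of
    [X - f] at the grid point that replaces the zero. *)
Definition no_descent (u : R) (h : R^nat) (N : nat) : set T :=
  [set w | forall i, (i < N)%N ->
    - (2 * Num.sqrt (h i)) <= X (u + h i) w - X u w].

Lemma measurable_no_descent u h N : measurable (no_descent u h N).
Proof.
rewrite (_ : no_descent u h N = \bigcap_(i in [set i | (i < N)%N])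
    increment_in X u (u + h i) `[- (2 * Num.sqrt (h i)), +oo[).
  by apply: bigcap_measurableType => i _; exact: (measurable_increment hX).
apply/seteqP; split => w H i /H /=; rewrite /increment_in /= in_itv/= andbT//.
Qed.

Lemma increment_in_itvcy_le s t c a : 0 <= s -> s < t ->
  Num.sqrt (t - s) * c <= a ->
  (P (increment_in X s t `[a, +oo[) <= normal_prob 0 1 `[c, +oo[)%E.
Proof.
move=> s0 st ca; rewrite -(gi_tail hX c s0 st).
have E b : [set w | b <= X t w - X s w] = increment_in X s t `[b, +oo[.
  by apply/funext => w; rewrite /increment_in/= in_itv/= andbT.
rewrite E; apply: le_measure; rewrite ?inE; [exact: (measurable_increment hX)..|].
move=> w; rewrite /increment_in/= !in_itv/= !andbT.
exact: le_trans.
Qed.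

(* The increments between the times u + h i.+1 and u + h i are independent and
   each is >= - 3 sqrt (h i) with probability bounded away from
   1, while the remaining part of X (u + h i) - X u is negligible on the scale
   sqrt (h i) when L is large. *)
Lemma no_descent_small (eta : R) : 0 < eta -> exists N : nat, exists2 L : R,
  2 <= L & forall (p : R^nat) K (S : set T) (h : R^nat),
    0 <= p 0%N -> nondecreasing_seq p -> past X p K S ->
    (forall i, 0 < h i) -> (forall i, L * h i.+1 <= h i) ->
    (P (S `&` no_descent (p K) h N) <= P S * eta%:E)%E.
Proof.
move=> eta0.
pose nu : probability _ R := normal_prob 0 (1 : R).
(* Since [h i.+1 <= h i / 2], [sqrt (h i)] is at most twice the standard deviation
   [sqrt (h i - h i.+1)], so the bound [- 3 sqrt (h i)] is at least -6 standard deviations. *)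
pose A6 : set R := `[-6%:R, +oo[%classic.
have mA6 : measurable A6 by exact: measurable_itv.
pose rho := fine (nu A6).
have rhoE : nu A6 = rho%:E by rewrite fineK// fin_num_measure.
have rho0 : 0 <= rho by rewrite fine_ge0.
have rho1 : rho < 1.
  by have := normal_prob_itvcy_lt1 (-6%:R : R); rewrite -/(nu _) -/A6 rhoE lte_fin.
have [N rhoN] : exists N, rho ^+ N <= eta / 2.
  have /cvg_expr/cvgrPdist_lt : `|rho| < 1 by rewrite ger0_norm.
  move=> /(_ (eta / 2)); rewrite divr_gt0// => /(_ isT) He.
  near \oo => N; exists N.
  have : `|0 - rho ^+ N| < eta / 2 by near: N.
  by rewrite sub0r normrN ger0_norm ?exprn_ge0// => /ltW.
(* Half of [eta] pays for the [N] independent increments; the other half is shared by the [N]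
   remainder events [V i]. Taking [L >= c ^+ 2] makes [sqrt (h i)] at least [c] standard deviations
   of the remainder. *)
pose e := eta / 2 / N.+1%:R.
have e0 : 0 < e by rewrite !divr_gt0.
have [c c0 ce] := normal_prob_itvcy_small e0.
pose L := Num.max 2 (c ^+ 2).
have L2 : 2 <= L by rewrite le_max lexx.
have Lc : c ^+ 2 <= L by rewrite le_max lexx orbT.
exists N, L => // p K S h p0 pnd pS h0 hL.
have p0n n : 0 <= p n by apply: le_trans p0 (pnd _ _ _).
set u := p K.
have u0 : 0 <= u by exact: p0n.
have h2 i : 2 * h i.+1 <= h i.
  by apply: le_trans (hL i); rewrite ler_pM2r.
have hc i : c ^+ 2 * h i.+1 <= h i.
  by apply: le_trans (hL i); rewrite ler_pM2r.
have mS : measurable S by exact: past_measurable hX _ _ _ pS.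
(* As [h] decreases, the index is reversed to list the times in increasing order; the first one,
   [u + h N], already lies after [u]. *)
pose q j := u + h (N - j)%N.
have hnd : nonincreasing_seq h.
  by apply/nonincreasing_seqP => i; have := h2 i; have := h0 i.+1; lra.
have qnd : nondecreasing_seq q.
  by move=> i j ij; rewrite /q lerD2l; apply: hnd; rewrite leq_sub2l.
pose A j : set R := `[- (3 * Num.sqrt (h (N - j.+1)%N)), +oo[%classic.
pose D1 := box X q A 0 N.
have mA j : measurable (A j) by exact: measurable_itv.
have PD1 : (P (S `&` D1) <= P S * (eta / 2)%:E)%E.
  have pq : p K <= q 0%N by rewrite /q lerDl ltW.
  rewrite (past_future_independent hX N p0 pnd qnd pq mA pS).
  apply: lee_wpmul2l => //.
  apply: (@le_trans _ _ (rho ^+ N)%:E); last by rewrite lee_fin.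
  apply: prode_le_expr => j jN; rewrite measure_ge0/= -rhoE.
  rewrite /A /q -(subnSK jN); set k := (N - j.+1)%N.
  have dk : 0 < h k - h k.+1 by have := h2 k; have := h0 k.+1; lra.
  apply: increment_in_itvcy_le.
  - by rewrite addr_ge0// ltW.
  - by rewrite ltrD2l -subr_gt0.
  - have -> : u + h k - (u + h k.+1) = h k - h k.+1 by ring.
    rewrite mulrN lerN2.
    suff : Num.sqrt (h k) <= 2 * Num.sqrt (h k - h k.+1) by lra.
    rewrite -[leRHS]ger0_norm ?mulr_ge0 ?sqrtr_ge0// -sqrtr_sqr.
    rewrite ler_wsqrtr// exprMn sqr_sqrtr ?(ltW dk)//.
    by have := h2 k; lra.
pose V i : set T := increment_in X u (u + h i.+1) `[Num.sqrt (h i), +oo[.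
have mV i : measurable (V i) by exact: (measurable_increment hX).
have PV i : (P (S `&` V i) <= P S * e%:E)%E.
  pose q' j := if j is 0%N then u else u + h i.+1.
  have q'nd : nondecreasing_seq q'.
    apply/nondecreasing_seqP => -[|j]//=.
    by rewrite lerDl ltW.
  have := past_future_independent hX 1 p0 pnd q'nd (lexx _)
    (fun=> measurable_itv `[Num.sqrt (h i), +oo[) pS.
  rewrite big_nat1/= => E.
  have -> : V i = box X q' (fun=> `[Num.sqrt (h i), +oo[%classic) 0 1.
    by apply/seteqP; split => [w Vw [|j]|w /(_ 0%N isT)].
  rewrite E; apply: lee_wpmul2l => //; apply: le_trans ce.
  apply: increment_in_itvcy_le => //; first by rewrite ltrDl.
  rewrite addrAC subrr add0r -(ger0_norm (ltW c0)) -sqrtr_sqr -sqrtrM ?(ltW (h0 _))//.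
  by rewrite ler_wsqrtr// mulrC.
(* Where [V k] fails, the increment from [u + h k.+1] to [u + h k] is at least
   [- 2 sqrt (h k) - sqrt (h k)], which is the bound in [A]. *)
have Dsub : S `&` no_descent u h N `<=`
    (S `&` D1) `|` \big[setU/set0]_(i < N) (S `&` V i).
  move=> w [Sw Dw]; rewrite -(bigcup_mkord N (fun i => S `&` V i)).
  have [[i iN Vi]|nV] := pselect (exists2 i, (i < N)%N & V i w).
    by right; exists i.
  left; split => // j /andP[_ jN]; rewrite /A/= in_itv/= andbT /q -(subnSK jN).
  set k := (N - j.+1)%N.
  have kN : (k < N)%N by rewrite /k ltn_subrL (leq_ltn_trans _ jN).
  have nVk : ~ V k w by move=> Vk; apply: nV; exists k.
  have := Dw k kN.
  have : X (u + h k.+1) w - X u w < Num.sqrt (h k).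
    rewrite ltNge; apply/negP => H; apply: nVk.
    by rewrite /V /increment_in/= in_itv/= andbT.
  lra.
have mSD1 : measurable (S `&` D1).
  by apply: measurableI => //; exact: (measurable_box hX).
have mSV i : measurable (S `&` V i) by exact: measurableI.
apply: (@le_trans _ _ (P (S `&` D1) + \sum_(i < N) P (S `&` V i)))%E.
  apply: (@le_trans _ _ (P ((S `&` D1) `|` \big[setU/set0]_(i < N) (S `&` V i)))).
    apply: le_measure => //; rewrite inE.
      by apply: measurableI => //; exact: measurable_no_descent.
    by apply: measurableU => //; exact: bigsetU_measurable.
  apply: le_trans (measureU2 _ mSD1 _) _; first exact: bigsetU_measurable.
  by apply: leeD2l; apply: (@Boole_inequality _ _ _ P (fun i => S `&` V i)).
apply: (@le_trans _ _ (P S * (eta / 2)%:E + \sum_(i < N) P S * e%:E))%E.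
  by apply: leeD => //; apply: lee_sum => i _; exact: PV.
have fS : P S \is a fin_num by exact: fin_num_measure.
rewrite -(fineK fS) -EFinM sumEFin -EFinD lee_fin.
rewrite sumr_const card_ord -[(_ * e) *+ N]mulr_natr -mulrA -mulrDr.
rewrite ler_wpM2l ?fine_ge0//.
suff : e * N%:R <= eta / 2 by lra.
by rewrite /e mulrAC ler_pdivrMr// ler_pM2l ?divr_gt0// ler_nat.
Unshelve. all: by end_near. Qed.

End no_descent.

(** * Measurable covers of events that hold eventually *)

Section eventually_measure.
Context {d : measure_display} {T : measurableType d} {R : realType}.
Variable P : probability T R.

(* A reformulation of P (liminf F n) <= liminf P (F n). *)
Lemma eventually_cover (F : (set T)^nat) (c : \bar R) :
  (forall n, measurable (F n)) -> (forall n, P (F n) <= c)%E ->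
  exists M, [/\ measurable M, (P M <= c)%E &
    forall w, (\forall n \near \oo, F n w) -> M w].
Proof.
move=> mF Fc.
pose E k := \bigcap_(n in [set n | (k <= n)%N]) F n.
have mE k : measurable (E k) by apply: bigcap_measurableType => n _.
exists (\bigcup_k E k); split.
- exact: bigcupT_measurable.
- have cv : P (E k) @[k --> \oo] --> P (\bigcup_k E k).
    apply: nondecreasing_cvg_mu => //; first exact: bigcupT_measurable.
    move=> i j ij; apply/subsetPset => w Ew n /= jn.
    by apply: Ew; exact: leq_trans jn.
  rewrite -(cvg_lim _ cv)//; apply: lime_le.
    by apply/cvg_ex; exists (P (\bigcup_k E k)).
  apply: nearW => k; apply: le_trans (Fc k); apply: le_measure; rewrite ?inE//.
  by move=> w; apply => /=.
- by move=> w [k _ H]; exists k => // n /= kn; exact: H.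
Qed.

End eventually_measure.

(** * First hits on a grid, in place of a stopping time *)

Section grid_events.
Context {d : measure_display} {T : measurableType d} {R : realType}.
Variables (P : probability T R) (X : R -> T -> R).
Hypothesis hX : gaussian_increments P X.
Variables (f : R -> R) (q eps : R).
Hypothesis q0 : 0 < q.
Variables (N : nat) (L : R).

(** Subtracting [X 0] makes the values at grid times sums of increments, hence measurable for
    [past]; for paths started at 0 nothing changes. *)
Definition drifted (t : R) (w : T) : R := X t w - X 0 w - f t.

Definition grid (n k : nat) : R := q + k%:R / n.+1%:R.

(** Time 0 is put in front, so [grid n k] has index [k.+1] and the increments from time 0 determine
    [drifted] on the grid. *)
Definition grid_times (n : nat) : R^nat :=
  fun j => if j is j'.+1 then grid n j' else 0.

Definition first_hit (m n k : nat) : set T :=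
  [set w | (forall j, (j < k)%N -> m.+1%:R^-1 < `|drifted (grid n j) w|) /\
           `|drifted (grid n k) w| <= m.+1%:R^-1].

(* If f has such scales at tau, then the same h works at all points u near tau;
   the bound r keeps u + h i to the right of tau. *)
Definition slow_scales (u r : R) (h : R^nat) : Prop :=
  [/\ (forall i, 0 < h i), (forall i, L * h i.+1 <= h i), h 0%N < eps / 2,
      r <= h N & forall i, (i < N)%N -> - Num.sqrt (h i) < f (u + h i) - f u].

(** The scales are chosen from [u] and [r] alone, independently of the path. Where none exist the
    event is empty, which keeps the upper bound on its probability. *)
Definition no_slow_descent (u r : R) : set T :=
  if pselect (exists h, slow_scales u r h) is left H
  then no_descent X u (sval (cid H)) N else set0.

Definition hit_no_descent (r m n : nat) : set T :=
  \bigcup_k (first_hit m n k `&` no_slow_descent (grid n k) r.+1%:R^-1).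

Lemma grid_times_nd n : nondecreasing_seq (grid_times n).
Proof.
apply/nondecreasing_seqP => -[|j] /=; rewrite /grid.
  by rewrite mul0r addr0 ltW.
by rewrite lerD2l ler_pM2r ?invr_gt0// ler_nat.
Qed.

Lemma past_first_hit m n k : past X (grid_times n) k.+1 (first_hit m n k).
Proof.
pose TG := g_sigma_algebraType (past_boxes X (grid_times n) k.+1).
have mhit j (A : set R) : (j <= k)%N -> measurable A ->
    measurable ([set w | A (drifted (grid n j) w)] : set TG).
  move=> jk mA.
  have -> : [set w | A (drifted (grid n j) w)] = [set w |
     ((fun x => x - f (grid n j)) @^-1` A)
       (X (grid_times n j.+1) w - X (grid_times n 0) w)] by [].
  apply: past_value => //.
  have mf : measurable_fun setT (fun x : R => x - f (grid n j)).
    by apply: measurable_funB.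
  by have := mf measurableT A mA; rewrite setTI.
have mn1 : measurable [set x : R | m.+1%:R^-1 < `|x|].
  have mf : measurable_fun setT (fun x : R => `|x|) by exact: normr_measurable.
  have := mf measurableT `]m.+1%:R^-1, +oo[%classic (measurable_itv _).
  rewrite setTI; congr measurable; apply/funext => x /=.
  by rewrite in_itv/= andbT.
rewrite (_ : first_hit m n k =
    (\bigcap_(j in [set j | (j < k)%N])
       [set w | m.+1%:R^-1 < `|drifted (grid n j) w|]) `&`
    ~` [set w | m.+1%:R^-1 < `|drifted (grid n k) w|]); last first.
  apply/seteqP; split => w [H1 /= H2]; split => //.
    by apply/negP; rewrite -leNgt.
  by rewrite leNgt; apply/negP.
apply: (@measurableI _ TG).
  apply: (@bigcap_measurableType _ TG) => j /= jk.
  exact: (mhit j _ (ltnW jk) mn1).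
by apply: (@measurableC _ TG); exact: (mhit k _ (leqnn k) mn1).
Qed.

Lemma measurable_first_hit m n k : measurable (first_hit m n k).
Proof. by apply: (past_measurable hX); exact: past_first_hit. Qed.

Lemma measurable_no_slow_descent u r : measurable (no_slow_descent u r).
Proof.
rewrite /no_slow_descent; case: pselect => // H.
exact: (measurable_no_descent hX).
Qed.

Lemma measurable_hit_no_descent r m n : measurable (hit_no_descent r m n).
Proof.
apply: bigcupT_measurable => k; apply: measurableI.
  exact: measurable_first_hit.
exact: measurable_no_slow_descent.
Qed.

(** Conditionally on the first hit at index [k], the probability is at most [eta]; the first-hit
    events are disjoint in [k], so their probabilities sum to at most 1. *)
Lemma hit_no_descent_le (eta : R) : 0 < eta ->
  (forall (p : R^nat) K (S : set T) (h : R^nat),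
    0 <= p 0%N -> nondecreasing_seq p -> past X p K S ->
    (forall i, 0 < h i) -> (forall i, L * h i.+1 <= h i) ->
    (P (S `&` no_descent X (p K) h N) <= P S * eta%:E)%E) ->
  forall r m n, (P (hit_no_descent r m n) <= eta%:E)%E.
Proof.
move=> eta0 small r m n.
have mT := measurable_first_hit m n.
have mTD k : measurable (first_hit m n k `&` no_slow_descent (grid n k) r.+1%:R^-1).
  by apply: measurableI => //; exact: measurable_no_slow_descent.
have mG := measurable_hit_no_descent r m n.
apply: le_trans (generalized_Boole_inequality P mTD mG) _.
apply: (@le_trans _ _ (\sum_(0 <= k <oo) eta%:E * P (first_hit m n k)))%E.
  apply: lee_nneseries => // k _; rewrite muleC.
  rewrite /no_slow_descent; case: pselect => [H|_]; last first.
    by rewrite setI0 measure0 mule_ge0// lee_fin ltW.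
  case: cid => h /= [h1 h2 _ _ _].
  exact: (small (grid_times n) k.+1 (first_hit m n k) h (lexx 0)
    (@grid_times_nd n) (@past_first_hit m n k) h1 h2).
rewrite nneseriesZl ?lee_fin ?(ltW eta0)//.
have disj : trivIset setT (first_hit m n).
  apply/ltn_trivIset => k l kl; apply/seteqP; split => // w [[_ H1] [H2 _]].
  by have := H2 _ kl; rewrite ltNge H1.
have := @measure_bigcup _ _ _ P setT (first_hit m n) (fun i _ => mT i) disj.
under eq_eseriesl do rewrite in_setT.
move=> <-.
rewrite -[leRHS]mule1; apply: lee_wpmul2l; first by rewrite lee_fin ltW.
by apply: probability_le1; exact: bigcupT_measurable.
Qed.

End grid_events.

Lemma continuous_at_dist (R : realType) (g : R -> R) (t e : R) :
  {for t, continuous g} -> 0 < e ->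
  exists2 r : R, 0 < r & forall u, `|u - t| < r -> `|g u - g t| < e.
Proof.
move=> /cvgrPdist_lt cg e0; have /nbhs_ballP[r r0 Hr] := cg e e0.
exists r => // u ur; rewrite distrC; apply: Hr.
by rewrite /ball/= distrC.
Qed.

(** * Deterministic analysis of one path near a slow zero *)

Section path_hits.
Context {d : measure_display} {T : measurableType d} {R : realType}.
Variables (X : R -> T -> R) (f : R -> R) (q eps : R) (N : nat) (L : R).
Hypotheses (q0 : 0 < q) (eps0 : 0 < eps) (L2 : 2 <= L).
Variables (w : T) (tau : R).
Hypothesis cf : forall t : R, 0 < t -> {for t, continuous f}.
Hypothesis cX : forall t : R, 0 < t -> {for t, continuous (X ^~ w)}.
Local Notation y := (fun t => drifted X f t w).
Hypothesis qtau : q < tau.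
Hypothesis ytau : y tau = 0.
Hypothesis y_before : forall s, q <= s -> s < tau -> y s <> 0.
Hypothesis y_after : forall s, tau < s -> s < tau + eps -> 0 < y s.
Hypothesis slow : forall e : R, 0 < e ->
  exists h : R, [/\ 0 < h, h < e & - Num.sqrt h < f (tau + h) - f tau].

Let tau0 : 0 < tau. Proof. exact: lt_trans qtau. Qed.
Let L0 : 0 < L. Proof. exact: lt_le_trans L2. Qed.

Let L1 : 1 <= L. Proof. by apply: le_trans L2; rewrite ler1n. Qed.

Let cy (t : R) : 0 < t -> {for t, continuous y}.
Proof.
move=> t0; apply: cvgB; last exact: cf.
by apply: cvgB; [exact: cX|exact: cvg_cst].
Qed.

Let scales_tau : exists h : R^nat, [/\ (forall i, 0 < h i),
  (forall i, L * h i.+1 <= h i), h 0%N < eps / 2 &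
  forall i, - Num.sqrt (h i) < f (tau + h i) - f tau].
Proof.
have /choice[g gP] (e : R) : exists h : R, 0 < e ->
    [/\ 0 < h, h < e & - Num.sqrt h < f (tau + h) - f tau].
  case: (ltP 0 e) => e0; last by exists 0.
  by have [h H] := slow e0; exists h.
have eh : 0 < eps / 2 by rewrite divr_gt0.
(* Each scale is picked below the previous one divided by [L], starting below [eps / 2]. *)
pose h n := iter n (fun x => g (x / L)) (g (eps / 2)).
have h0 n : 0 < h n.
  elim: n => [|n IH] /=; first by have [] := gP (eps / 2) eh.
  by have [] := gP (h n / L) (divr_gt0 IH L0).
exists h; split => //.
- move=> i; have [_ + _] := gP (h i / L) (divr_gt0 (h0 i) L0).
  by rewrite -/(h i.+1) ltr_pdivlMr// mulrC => /ltW.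
- by have [] := gP (eps / 2) eh.
- case => [|i]; first by have [] := gP (eps / 2) eh.
  by have [] := gP (h i / L) (divr_gt0 (h0 i) L0).
Qed.

(** Only the finitely many strict inequalities with [i < N] are needed; by continuity of [f] they
    persist when [tau] is replaced by a nearby [u]. *)
Let scales_near : exists2 rho : R, 0 < rho & exists2 e : R, 0 < e & forall u r : R,
  `|u - tau| < e -> r <= rho -> exists h, slow_scales f eps N L u r h.
Proof.
have [h [h0 hL he hs]] := scales_tau.
exists (h N) => //.
have [e e0 He] : exists2 e : R, 0 < e & forall i, (i < N)%N -> forall u,
    `|u - tau| < e -> - Num.sqrt (h i) < f (u + h i) - f u.
  elim: N => [|n [e e0 IH]]; first by exists 1.
  pose a := (f (tau + h n) - f tau + Num.sqrt (h n)) / 2.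
  have a0 : 0 < a by have := hs n; rewrite /a; lra.
  have [r1 r10 H1] := continuous_at_dist (cf tau0) a0.
  have [r2 r20 H2] := continuous_at_dist (cf (addr_gt0 tau0 (h0 n))) a0.
  exists (Num.min e (Num.min r1 r2)); first by rewrite !lt_min e0 r10.
  move=> i; rewrite ltnS leq_eqVlt => /predU1P[->|i_n] u; rewrite !lt_min.
    move=> /and3P[_ /H1 u1 u2].
    have : `|f (u + h n) - f (tau + h n)| < a.
      by apply: H2; rewrite opprD addrACA subrr addr0.
    move: u1; rewrite !ltr_norml /a => /andP[? ?] /andP[? ?]; lra.
  by move=> /andP[ue _]; exact: IH.
exists e => // u r ue rN; exists h; split => //.
by move=> i iN; exact: He.
Qed.

(** The order of the limits matters: [r] bounds the scales from below, then the level [1 / (m + 1)]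
    is taken small compared with the scales, then the mesh [1 / (n + 1)] small enough for the grid
    to hit that level just before [tau]. *)
Lemma eventually_hit_no_descent :
  \forall r \near \oo, \forall m \near \oo, \forall n \near \oo,
    hit_no_descent X f q eps N L r m n w.
Proof.
have [rho rho0 [e e0 sc]] := scales_near.
near=> r.
have rrho : r.+1%:R^-1 <= rho.
  by apply/ltW; near: r; exact: (near_infty_natSinv_lt (PosNum rho0)).
pose r' : R := r.+1%:R^-1; rewrite -/r' in rrho.
have r'0 : 0 < r' by rewrite invr_gt0.
have sr0 : 0 < Num.sqrt r' by rewrite sqrtr_gt0.
(* A hit [u] in [(tau - e1, tau]] is close enough to [tau] for scales to exist, and [u + h i > tau]
   as [h i >= r']; the third bound keeps [[q, tau - e1]] nonempty. *)
pose e1 := Num.min (Num.min e r') (tau - q).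
have e10 : 0 < e1 by rewrite !lt_min e0 r'0 subr_gt0.
have [e1e e1r e1q] : [/\ e1 <= e, e1 <= r' & e1 <= tau - q].
  by split; rewrite !ge_min lexx ?orbT.
(* The minimum of [|y|] on a compact interval without zeros; levels below [c] are not hit before
   [tau - e1]. *)
have [c c0 yc] : exists2 c : R, 0 < c & forall s, q <= s -> s <= tau - e1 ->
    c <= `|y s|.
  have qe : q <= tau - e1 by lra.
  have cn : {within `[q, tau - e1], continuous (fun s => `|y s|)}.
    apply: continuous_in_subspaceT => s; rewrite inE/= in_itv/= => /andP[qs _].
    by apply: cvg_norm; apply: cy; exact: lt_le_trans qs.
  have [s + Hs] := EVT_min qe cn.
  rewrite in_itv/= => /andP[qs se].
  exists `|y s|.
    by rewrite normr_gt0; apply/eqP; apply: y_before => //; lra.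
  by move=> t qt te; apply: Hs; rewrite in_itv/= qt.
near=> m.
have mc : m.+1%:R^-1 < c by near: m; exact: (near_infty_natSinv_lt (PosNum c0)).
have mr : m.+1%:R^-1 < Num.sqrt r'.
  by near: m; exact: (near_infty_natSinv_lt (PosNum sr0)).
pose m' : R := m.+1%:R^-1; rewrite -/m' in mc mr.
have m'0 : 0 < m' by rewrite invr_gt0.
have [e2 e20 He2] := continuous_at_dist (cy tau0) m'0.
near=> n.
have n0 : 0 < n.+1%:R :> R by [].
have ne2 : n.+1%:R^-1 < e2.
  by near: n; exact: (near_infty_natSinv_lt (PosNum e20)).
have [k kP kmin] : exists2 k, `|y (grid q n k)| <= m' /\ grid q n k <= tau &
    forall j, (j < k)%N -> m' < `|y (grid q n j)|.
  (* The last grid point not after [tau]: it is within one mesh of [tau], so [|y|] is small there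
     and a first hit exists no later than [tau]. *)
  pose k0 := Num.trunc ((tau - q) * n.+1%:R).
  have k00 : 0 <= (tau - q) * n.+1%:R by rewrite mulr_ge0// subr_ge0 ltW.
  have /andP[k01 k02] := truncn_itv k00; rewrite -/k0 in k01 k02.
  have gk0 : grid q n k0 <= tau.
    by rewrite /grid -lerBrDl ler_pdivrMr.
  have gk1 : tau - n.+1%:R^-1 < grid q n k0.
    rewrite /grid; move: k02; rewrite -ltr_pdivlMr// -[k0.+1%:R]natr1 mulrDl mul1r.
    set a := _ / _; set b := _^-1 => ?; lra.
  have gk2 : tau - e2 < grid q n k0.
    by apply: lt_trans gk1; rewrite ltrD2l ltrN2.
  have yk0 : `|y (grid q n k0)| <= m'.
    apply/ltW; have := He2 (grid q n k0); rewrite ytau subr0; apply.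
    rewrite ler0_norm; lra.
  have Hex : exists k, `|y (grid q n k)| <= m' by exists k0.
  case: (ex_minnP Hex) => k yk kmin; exists k; last first.
    by move=> j jk; rewrite ltNge; apply: contraTN jk => /kmin; rewrite -leqNgt.
  split => //; apply: le_trans gk0; rewrite /grid lerD2l ler_pM2r ?invr_gt0//.
  by rewrite ler_nat; exact: kmin.
case: kP => yk ktau; exists k => //; split; first by split.
set u := grid q n k in yk ktau *.
have qu : q <= u by rewrite /u /grid lerDl.
have tu : tau - e1 < u.
  rewrite ltNge; apply/negP => ue; have := yc u qu ue; lra.
have ue : `|u - tau| < e.
  by rewrite ler0_norm ?subr_le0//; lra.
(* The chosen scales need not be those of [scales_near], which only supplies existence; what follows
   relies on [slow_scales] alone. *)
rewrite /no_slow_descent; case: pselect => [H|]; last by apply; exact: sc.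
case: cid => h /= [h0 hL he hN hs] i iN.
have hnd : nonincreasing_seq h.
  apply/nonincreasing_seqP => j; apply: le_trans (hL j).
  by rewrite ler_peMl ?(ltW (h0 _)).
have rhi : r' <= h i by apply: le_trans hN _; apply: hnd; exact: ltnW.
have hi0 : h i <= h 0%N by exact: hnd.
have yi : 0 < y (u + h i) by apply: y_after; lra.
have sri : Num.sqrt r' <= Num.sqrt (h i) by rewrite ler_wsqrtr.
(* Positivity of [y] at [u + h i] bounds the increment of [X] below by [f (u + h i) - f u - m'],
   where [m'] and the drop of [f] are both less than [sqrt (h i)]. *)
have := hs i iN; move: yi yk; rewrite /drifted ler_norml => ? /andP[? ?] ?.
lra.
Unshelve. all: by end_near. Qed.

End path_hits.

(** * Negligibility of slow zeros *)

Section slow_zeros.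
Context {d : measure_display} {T : measurableType d} {R : realType}.
Variables (P : probability T R) (X : R -> T -> R).
Hypothesis hX : gaussian_increments P X.
Variable f : R -> R.
Hypothesis cf : forall t : R, 0 < t -> {for t, continuous f}.

(** The growth condition concerns [- f], because a path that stays above [f] after [tau] can do so
    only if [f] falls fast. Measurability of this event is not established; the estimates go through
    measurable supersets. *)
Definition slow_positive_zero (q eps : R) : set T :=
  [set w | [/\ 0 < q, 0 < eps,
     forall t : R, 0 < t -> {for t, continuous (X ^~ w)} &
     exists tau : R, [/\ q < tau, drifted X f tau w = 0,
       forall s, q <= s -> s < tau -> drifted X f s w <> 0,
       forall s, tau < s -> s < tau + eps -> 0 < drifted X f s w &
       ~ sqrt_growth_points (fun t => - f t) tau]]].

Lemma not_sqrt_growth_point (g : R -> R) (t : R) : 0 <= t ->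
  ~ sqrt_growth_points g t -> forall e : R, 0 < e ->
  exists h : R, [/\ 0 < h, h < e & g (t + h) - g t < Num.sqrt h].
Proof.
move=> t0 ng e e0; apply: contrapT => nh; apply: ng; split => //.
exists e => // h h0 he; rewrite leNgt; apply/negP => gh; apply: nh.
by exists h.
Qed.

(** The three nested limits, in [n], then [m], then [r], are removed from the inside out, each by a
    measurable cover that keeps the bound [eta]. *)
Lemma slow_positive_zero_small q eps (eta : R) : 0 < eta ->
  exists M, [/\ measurable M, (P M <= eta%:E)%E &
    slow_positive_zero q eps `<=` M].
Proof.
move=> eta0.
have [q0|qN] := ltP 0 q; last first.
  exists set0; split => //; first by rewrite measure0 lee_fin ltW.
  by move=> w [] /(le_lt_trans qN); rewrite ltxx.
have [N [L L2 small]] := no_descent_small hX eta0.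
pose G := hit_no_descent X f q eps N L.
have mG r m n : measurable (G r m n) by exact: (measurable_hit_no_descent hX).
have Geta := hit_no_descent_le hX f eps q0 eta0 small.
have /choice[M1 M1P] (rm : nat * nat) :=
  eventually_cover (mG rm.1 rm.2) (Geta rm.1 rm.2).
have /choice[M2 M2P] (r : nat) : exists M, [/\ measurable M, (P M <= eta%:E)%E &
    forall w, (\forall m \near \oo, M1 (r, m) w) -> M w].
  by apply: eventually_cover => m; have [] := M1P (r, m).
have [M [mM PM MP]] : exists M, [/\ measurable M, (P M <= eta%:E)%E &
    forall w, (\forall r \near \oo, M2 r w) -> M w].
  by apply: eventually_cover => r; have [] := M2P r.
exists M; split => // w [_ eps0 cX [tau [qtau ytau yb ya nA]]].
have slow (e : R) : 0 < e ->
    exists h : R, [/\ 0 < h, h < e & - Num.sqrt h < f (tau + h) - f tau].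
  move=> e0; have tau0 : 0 <= tau by rewrite ltW// (lt_trans q0).
  have [h [h0 he hs]] := not_sqrt_growth_point tau0 nA e0.
  by exists h; split => //; lra.
have H := @eventually_hit_no_descent _ _ _ X f q eps N L q0 eps0 L2 w tau cf cX
  qtau ytau yb ya slow.
apply: MP; apply: filterS H => r H; have [_ _] := M2P r; apply.
apply: filterS H => m H; have [_ _] := M1P (r, m); apply.
exact: H.
Qed.

Lemma slow_positive_zero_negligible q eps :
  P.-negligible (slow_positive_zero q eps).
Proof.
have /choice[M MP] (n : nat) : exists M, [/\ measurable M,
    (P M <= (n.+1%:R^-1)%:E)%E & slow_positive_zero q eps `<=` M].
  by apply: slow_positive_zero_small; rewrite invr_gt0.
have mM : measurable (\bigcap_n M n).
  by apply: bigcap_measurableType => n _; have [] := MP n.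
exists (\bigcap_n M n); split => //; last first.
  by move=> w Hw n _; have [_ _] := MP n; apply.
apply/eqP; rewrite eq_le measure_ge0 andbT.
apply/lee_addgt0Pr => e e0; rewrite add0e.
near \oo => n.
have [mn Pn _] := MP n.
apply: (@le_trans _ _ (P (M n))).
  by apply: le_measure; rewrite ?inE// => w; exact.
apply: le_trans Pn _; rewrite lee_fin ltW//.
by near: n; exact: (near_infty_natSinv_lt (PosNum e0)).
Unshelve. all: by end_near. Qed.

End slow_zeros.

(** * Signs next to an isolated zero, and the countable union of null events *)

Lemma nonvanishing_sign (R : realType) (y : R -> R) (a b : R) :
  (forall t : R, a < t < b -> {for t, continuous y}) ->
  (forall t, a < t < b -> y t <> 0) ->
  (forall t, a < t < b -> 0 < y t) \/ (forall t, a < t < b -> 0 < - y t).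
Proof.
move=> cy y0.
have key s t : a < s -> s <= t -> t < b ->
    Num.min (y s) (y t) <= 0 <= Num.max (y s) (y t) -> False.
  move=> as_ st tb sgn.
  have cn : {within `[s, t], continuous y}.
    apply: continuous_in_subspaceT => x; rewrite inE/= in_itv/= => /andP[sx xt].
    by apply: cy; rewrite (lt_le_trans as_ sx) (le_lt_trans xt tb).
  have [x + yx] := IVT st cn sgn; rewrite in_itv/= => /andP[sx xt].
  by apply: (y0 x) => //; rewrite (lt_le_trans as_ sx) (le_lt_trans xt tb).
have [[s /andP[as_ sb] ys]|nex] := pselect (exists2 s, a < s < b & 0 < y s).
  left => t /andP[at_ tb]; rewrite ltNge; apply/negP => yt.
  have [st|ts] := leP s t.
    by apply: (key s t) => //; rewrite ge_min yt orbT le_max ltW.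
  by apply: (key t s (at_) (ltW ts)) => //; rewrite ge_min yt le_max (ltW ys) orbT.
right => t atb; rewrite oppr_gt0 ltNge; apply/negP => yt.
apply: nex; exists t => //; rewrite lt_neqAle yt andbT eq_sym.
by apply/eqP; exact: y0.
Qed.

Theorem theorem1p4 (d : measure_display) (T : measurableType d) (R : realType)
    (P : probability T R) (B : R -> {RV P >-> R})
    (hB : standard_brownian_motion B)
    (f : R -> R) (hf : {within `[0, +oo[, continuous f}) :
  exists A_f : set R,
    [/\ A_f `<=` `[0, +oo[,
        (hausdorff_dim A_f <= (2^-1)%:E)%E
      & {ae P, forall w, isolated (zeros (fun t => B t w - f t)) `<=` A_f}].
Proof.
pose f' t := - f t.
exists (sqrt_growth_points f `|` sqrt_growth_points f'); split.
- by move=> t []; case=> t0 _; rewrite /= in_itv/= t0.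
- exact: hausdorff_dim_sqrt_growth_points.
have pos_cont (g : R -> R) : {within `[0, +oo[, continuous g} ->
    forall t : R, 0 < t -> {for t, continuous g}.
  move=> /continuous_within_itvcyP[cg _] t t0.
  by apply: cg; rewrite in_itv/= t0.
have cf := pos_cont _ hf.
have cf' (t : R) : 0 < t -> {for t, continuous f'}.
  by move=> t0; apply: cvgN; exact: cf.
pose Bp (t : R) (w : T) : R := B t w.
pose Bm (t : R) (w : T) : R := - B t w.
have [code [decode codeK]] : exists (code : rat * rat -> nat)
    (decode : nat -> option (rat * rat)), pcancel code decode.
  by exists pickle, unpickle; exact: pickleK.
(* Rational [q] and [eps] suffice. The pair [Bm], [f'] reverses the sign of [B - f] and so covers
   zeros followed by negative values. *)
pose bad (n : nat) : set T :=
  if decode n is Some p then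
    slow_positive_zero Bp f (ratr p.1) (ratr p.2) `|`
    slow_positive_zero Bm f' (ratr p.1) (ratr p.2)
  else set0.
have badN : P.-negligible (\bigcup_n bad n).
  apply: negligible_bigcup => n; rewrite /bad.
  case: (decode n) => [p|]; last exact: negligible_set0.
  apply: negligibleU.
    apply: slow_positive_zero_negligible => //.
    exact: brownian_gaussian_increments.
  apply: slow_positive_zero_negligible => //.
  exact: brownianN_gaussian_increments.
have B0 := bm_start hB.
have Bc := bm_continuous hB.
(* By contraposition: a path with an isolated zero outside [A_f] does not start at 0, is
   discontinuous, or lies in some [bad n]. *)
apply: negligibleS (negligibleU (negligibleU B0 Bc) badN) => w /= H.
have [B0w|] := pselect (B 0 w = 0); last by left; left.
have [Bcw|] := pselect {within `[0, +oo[, continuous (B ^~ w)};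
  last by left; right.
right; have cB := pos_cont _ Bcw.
move: H => /existsNP[tau] /not_implyP[[tauz [V nV VE]] nA].
move: tauz; rewrite inE => -[tau0 ztau].
have /nbhs_ballP[e e0 eV] := nV.
have noz (s : R) : 0 < s -> `|tau - s| < e -> s <> tau -> B s w - f s <> 0.
  move=> s0 se st zs; apply: st.
  suff : (V `&` zeros (fun t => B t w - f t)) s by rewrite VE.
  by split => //; apply: eV.
(* [q1] is taken in the zero-free stretch before [tau], so that [tau] is the first zero after it;
   [q2 < e] keeps the stretch after [tau] free of zeros. *)
have [q1 q1P] : exists q1 : rat, Num.max 0 (tau - e) < (ratr q1 : R) < tau.
  have := @rat_in_itvoo R (Num.max 0 (tau - e)) tau.
  rewrite gt_max tau0/= ltrBlDr ltrDl => /(_ e0)[q1].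
  by rewrite in_itv/= => Hq; exists q1.
have [q2 q2P] : exists q2 : rat, 0 < (ratr q2 : R) < e.
  by have [q2] := rat_in_itvoo e0; rewrite in_itv/= => Hq; exists q2.
move: q1P q2P; rewrite gt_max => /andP[/andP[q10 q1e] q1t] /andP[q20 q2e].
have cD (t : R) : 0 < t -> {for t, continuous (fun t => B t w - f t)}.
  by move=> t0; apply: cvgB; [exact: cB|exact: cf].
have [nAf nAf'] : ~ sqrt_growth_points f tau /\ ~ sqrt_growth_points f' tau.
  by split => H; apply: nA; [left|right].
have before s : ratr q1 <= s -> s < tau -> B s w - f s <> 0.
  move=> qs st; apply: noz; first exact: lt_le_trans qs.
    by rewrite gtr0_norm ?subr_gt0//; lra.
  by move=> E; rewrite E ltxx in st.
exists (code (q1, q2)) => //; rewrite /bad codeK/=.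
have DpE s : drifted Bp f s w = B s w - f s.
  by rewrite /drifted /Bp B0w subr0.
have DmE s : drifted Bm f' s w = - (B s w - f s).
  by rewrite /drifted /Bm /f' B0w oppr0 subr0 opprB opprK addrC.
have [| |sgn|sgn] := @nonvanishing_sign R (fun t => B t w - f t)
  tau (tau + ratr q2).
- by move=> t /andP[taut _]; apply: cD; exact: lt_trans taut.
- move=> t /andP[taut tq]; apply: noz; first exact: lt_trans taut.
    by rewrite ltr0_norm ?subr_lt0//; lra.
  by move=> E; rewrite E ltxx in taut.
- left; split => //; exists tau; split => //.
  + by rewrite DpE.
  + by move=> s; rewrite DpE; exact: before.
  + by move=> s ts se; rewrite DpE; apply: sgn; rewrite ts.
- right; split => //.
    by move=> t t0; apply: cvgN; exact: cB.
  exists tau; split => //.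
  + by rewrite DmE ztau oppr0.
  + move=> s q1s st; rewrite DmE => /eqP; rewrite oppr_eq0 => /eqP.
    exact: before.
  + by move=> s ts se; rewrite DmE; apply: sgn; rewrite ts.
  + suff -> : (fun t => - f' t) = f by [].
    by apply/funext => t; rewrite /f' opprK.
Qed.
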